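(* Let $G$ be a non-discrete locally compact unimodular group with Haar measure $\nu$. For every neighborhood $U$ of the identity and every compact set $B\subseteq G$ there exists a compact set $C\supseteq B$ that admits a $U$-fine equisize partition.
   Context: A finite partition $\mathcal P$ of a set $C\subseteq G$ into Haar-measurable sets is $U$-fine if for every $P\in\mathcal P$ there is $g\in G$ with $P\subseteq gU$, and equisize if all sets in $\mathcal P$ have the same Haar measure. *)

(* Defs.v *)
From HB Require Import structures.
From mathcomp Require Import all_boot all_order all_algebra.
From mathcomp Require Import all_classical all_reals all_analysis.
Set Implicit Arguments. Unset Strict Implicit. Unset Printing Implicit Defensive.
Import Order.TTheory GRing.Theory Num.Theory.
Local Open Scope classical_set_scope.
Local Open Scope ring_scope.

Definition is_group (T : Type) (mul : T -> T -> T) (inv : T -> T) (e : T) :=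
  [/\ forall x y z, mul x (mul y z) = mul (mul x y) z,
      forall x, mul e x = x /\ mul x e = x &
      forall x, mul (inv x) x = e /\ mul x (inv x) = e].

Definition is_topological_group (T : topologicalType)
    (mul : T -> T -> T) (inv : T -> T) (e : T) :=
  [/\ is_group mul inv e,
      continuous (fun p : T * T => mul p.1 p.2) &
      continuous inv].

Definition is_lc_group (T : topologicalType)
    (mul : T -> T -> T) (inv : T -> T) (e : T) :=
  [/\ is_topological_group mul inv e, hausdorff_space T &
      locally_compact [set: T]].

Definition discrete_topology_on (T : topologicalType) :=
  forall x : T, open [set x].

Definition borel (T : topologicalType) : set (set T) := <<s [set A | open A] >>.

Definition ltrans (T : Type) (mul : T -> T -> T) (g : T) (A : set T) : set T :=
  [set mul g a | a in A].
Definition rtrans (T : Type) (mul : T -> T -> T) (A : set T) (g : T) : set T :=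
  [set mul a g | a in A].

Definition haar_measure (R : realType) (T : topologicalType)
    (mul : T -> T -> T) (nu : set T -> \bar R) :=
  nu set0 = 0%E /\
      (forall A, borel A -> (0 <= nu A)%E) /\
      (forall F : nat -> set T, (forall n, borel (F n)) -> trivIset setT F ->
          (fun n => \sum_(0 <= i < n) nu (F i))%E @ \oo --> nu (\bigcup_n F n)) /\
      (forall g A, borel A -> nu (ltrans mul g A) = nu A) /\
      (forall K, compact K -> (nu K < +oo)%E) /\
      (forall O, open O -> O !=set0 -> (0 < nu O)%E) /\
      (forall A, borel A ->
          nu A = ereal_inf [set nu O | O in [set O | open O /\ A `<=` O]]) /\
      (forall O, open O ->
          nu O = ereal_sup [set nu K | K in [set K | compact K /\ K `<=` O]]).

Definition unimodular_haar (R : realType) (T : topologicalType)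
    (mul : T -> T -> T) (nu : set T -> \bar R) :=
  haar_measure mul nu /\ (forall g A, borel A -> nu (rtrans mul A g) = nu A).

Definition measurable_partition (T : topologicalType) (C : set T) (n : nat)
    (P : 'I_n -> set T) :=
  [/\ forall i, borel (P i),
      forall i, P i !=set0,
      forall i j, i != j -> P i `&` P j = set0 &
      \bigcup_(i in [set: 'I_n]) P i = C].

Definition U_fine (T : topologicalType) (mul : T -> T -> T) (U : set T)
    (n : nat) (P : 'I_n -> set T) :=
  forall i, exists g, P i `<=` ltrans mul g U.

Definition equisize (R : realType) (T : topologicalType) (nu : set T -> \bar R)
    (n : nat) (P : 'I_n -> set T) :=
  forall i j, nu (P i) = nu (P j).

(* Main.v *)
(* The group is cut along the left cosets of the open subgroup H generated by a
   compact symmetric neighborhood V of e with VV inside U. Inside H, a compact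
   set C0 is a finite union of translates s VV in which every new center s
   differs from an earlier one by a step in V, so that each new piece overlaps
   the previous ones in a set of measure at least nu(V). Let delta be a small
   fraction 1/N of nu(C0). Since a non-discrete group has no atoms, the last
   piece can be peeled off after borrowing at most delta from its overlap, so
   that a multiple of delta is removed; iterating cuts C0 into N sets of measure
   delta. Finally B is covered by finitely many pairwise disjoint left translates
   of C0, and these carry translated partitions with the same delta. *)
Require Import Defs.
From HB Require Import structures.
From mathcomp Require Import all_boot all_order all_algebra.
From mathcomp Require Import all_classical all_reals all_analysis.
From mathcomp Require Import lra.
Set Implicit Arguments. Unset Strict Implicit. Unset Printing Implicit Defensive.
Import Order.TTheory GRing.Theory Num.Theory.
Local Open Scope classical_set_scope.
Local Open Scope ring_scope.

(** * Finite disjoint unions of tiles *)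

(** Adding one tile at a time spares all index bookkeeping when tilings are joined or translated;
    [tileable_ord] recovers an indexed family at the end. *)
Inductive tileable (X : Type) (tile : set X -> Prop) : set X -> Prop :=
| tileable0 : tileable tile set0
| tileableU P A : tile P -> tileable tile A -> P `&` A = set0 ->
    tileable tile (P `|` A).

Lemma tileable_disjU (X : Type) (tile : set X -> Prop) (A B : set X) :
  tileable tile A -> tileable tile B -> A `&` B = set0 ->
  tileable tile (A `|` B).
Proof.
move=> tA tB; elim: tA => [|P A' tP _ IH PA'] AB; first by rewrite set0U.
move: AB; rewrite setIUl setU_eq0 => -[PB A'B].
rewrite -setUA; apply: tileableU => //; first exact: IH.
by rewrite setIUr PA' PB setU0.
Qed.

Lemma tileable1 (X : Type) (tile : set X -> Prop) (P : set X) :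
  tile P -> tileable tile P.
Proof.
by move=> tP; rewrite -(setU0 P); apply: tileableU; rewrite ?setI0//; left.
Qed.

(** * Subsets of prescribed measure *)

Section measure_tilings.
Context d (X : measurableType d) (R : realType) (mu : {measure set X -> \bar R}).
Implicit Types (A B M E : set X) (t eps delta c : R).

Lemma le_mu A B : measurable A -> measurable B -> A `<=` B -> (mu A <= mu B)%E.
Proof. by move=> mA mB; apply: le_measure; rewrite inE. Qed.

Lemma mu_setU A B : measurable A -> measurable B -> A `&` B = set0 ->
  mu (A `|` B) = (mu A + mu B)%E.
Proof. exact: measureU. Qed.

Lemma mu_setD A B : measurable A -> measurable B -> B `<=` A ->
  mu A = (mu (A `\` B) + mu B)%E.
Proof. by move=> mA mB /setIidr AB; rewrite (measureDI mu mA mB) AB. Qed.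

(** The sets of [ws] are removed from [A] one by one while measure at least [t] remains. The first
    removal that would go below [t] is not made: the set at hand then exceeds [t] by at most the
    measure of that [W]. *)
Lemma shrink_measure (ws : seq (set X)) A t eps : 0 <= t -> 0 <= eps ->
  (forall W, W \in ws -> measurable W /\ (mu W <= eps%:E)%E) ->
  measurable A -> (forall x, A x -> exists2 W, W \in ws & W x) ->
  (t%:E <= mu A)%E ->
  exists M, [/\ measurable M, M `<=` A, (t%:E <= mu M)%E &
    (mu M <= (t + eps)%:E)%E].
Proof.
move=> t0 eps0; elim: ws A => [|W ws IH] A Wws mA Acov tA.
  have A0 : A = set0.
    by apply/seteqP; split=> // x /Acov[].
  exists A; split => //.
  by rewrite A0 measure0 lee_fin addr_ge0.
have [mW We] := Wws W (mem_head _ _).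
have [tAW|AWt] := leP t%:E (mu (A `\` W)).
  have [||x [Ax nWx]||M [mM MA tM Mt]] := IH (A `\` W).
  - by move=> W' W'ws; apply: Wws; rewrite inE W'ws orbT.
  - exact: measurableD.
  - have [W' + W'x] := Acov _ Ax.
    by rewrite inE => /predU1P[W'E|]; [move: W'x; rewrite W'E|exists W'].
  - exact: tAW.
  - by exists M; split => // x /MA[].
exists A; split => //.
rewrite (measureDI mu mA mW) EFinD leeD//; first exact: ltW.
by apply: le_trans We; apply: measureIr.
Qed.

(** This is the intermediate value property of atomless measures, localized to one set. *)
Definition divisible A := forall t, 0 <= t -> (t%:E <= mu A)%E ->
  exists M, [/\ measurable M, M `<=` A & mu M = t%:E].

(** Repeated shrinking gives a decreasing sequence of sets with measures between [t] and
    [t + 1/(n+1)]. Since [mu A] is finite, continuity from above gives their intersection measure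
    exactly [t]. *)
Lemma divisible_fine_cover A : measurable A -> (mu A < +oo)%E ->
  (forall eps, 0 < eps -> exists2 ws : seq (set X),
    (forall W, W \in ws -> measurable W /\ (mu W <= eps%:E)%E) &
    forall x, A x -> exists2 W, W \in ws & W x) ->
  divisible A.
Proof.
move=> mA Aoo Acov t t0 tA.
pose good M := [/\ measurable M, M `<=` A & (t%:E <= mu M)%E].
(* The hypothesis [good] stands under the existential so that [choice] yields a function defined on
   all pairs. *)
have step (p : nat * set X) : exists M, good p.2 ->
    [/\ good M, M `<=` p.2 & (mu M <= (t + p.1.+1%:R^-1)%:E)%E].
  have [|] := pselect (good p.2); last by exists set0.
  case: p => n B /= [mB BA tB].
  have [|ws wsP wscov] := Acov n.+1%:R^-1; first by rewrite invr_gt0.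
  have [||M [mM MB tM Mt]] := shrink_measure t0 _ wsP mB _ tB.
  - by rewrite invr_ge0.
  - by move=> x /BA/wscov.
  - by exists M => _; split => //; split => //; apply: subset_trans BA.
have [f fP] := choice step.
pose F := fix F n := if n is m.+1 then f (m, F m) else A.
have Fgood n : good (F n).
  by elim: n => [|n /(fP (n, F n))[]]; first by split.
have Fsub n : F n.+1 `<=` F n by have [] := fP (n, F n) (Fgood n).
have Fle n : (mu (F n.+1) <= (t + n.+1%:R^-1)%:E)%E.
  by have [] := fP (n, F n) (Fgood n).
have mF n : measurable (F n) by have [] := Fgood n.
have mbigF : measurable (\bigcap_n F n) by exact: bigcap_measurable.
exists (\bigcap_n F n); split => //; first by move=> x /(_ 0%N I).
have cF : mu \o F @ \oo --> mu (\bigcap_n F n).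
  apply: nonincreasing_cvg_mu => //.
  by apply/nonincreasing_seqP => n; apply/subsetPset.
apply/eqP; rewrite eq_le; apply/andP; split.
- have ce : (fun n => (t + (n.+1%:R^-1 : R))%:E) @ \oo --> t%:E.
    apply: cvg_EFin; first by near=> n.
    rewrite -[X in _ --> X]addr0; apply: cvgD; first exact: cvg_cst.
    exact: cvg_harmonic.
  have cF' : (fun n => mu (F n.+1)) @ \oo --> mu (\bigcap_n F n).
    by rewrite (cvg_shiftS (mu \o F)).
  by apply: (lee_cvg_to cF' ce); exact: nearW.
- by apply: (lee_cvg_to (cvg_cst _) cF); apply: nearW => n; case: (Fgood n).
Unshelve. all: by end_near. Qed.

(** * Tiling a union of overlapping small sets *)

Definition measure_tile (small : set X -> Prop) delta (P : set X) :=
  [/\ measurable P, mu P = delta%:E & small P].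

(** The head of the list is the piece to be peeled off first, and [E] is what earlier peelings have
    borrowed. The base clause keeps the bottom piece [A0] from being used up. *)
Fixpoint overlapping c E A0 (l : seq (set X)) : Prop :=
  if l is A :: l' then
    (c%:E <= mu ((A `&` foldr setU A0 l') `\` E))%E /\ overlapping c E A0 l'
  else (c%:E <= mu (A0 `\` E))%E.

Lemma measurable_foldrU A0 l : measurable A0 ->
  (forall A, A \in l -> measurable A) -> measurable (foldr setU A0 l).
Proof.
move=> mA0; elim: l => //= A l IH ml; apply: measurableU.
  by apply: ml; rewrite mem_head.
by apply: IH => B Bl; apply: ml; rewrite inE Bl orbT.
Qed.

(** Borrowing [D] costs every overlap at most the measure of [D]. *)
Lemma overlapping_remove c r E D A0 l : measurable E -> measurable D ->
  measurable A0 -> (forall A, A \in l -> measurable A) ->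
  (mu D <= r%:E)%E -> overlapping c E A0 l -> overlapping (c - r) (E `|` D) A0 l.
Proof.
move=> mE mD mA0 + Dr.
have remove Y : measurable Y -> (c%:E <= mu (Y `\` E))%E ->
    ((c - r)%:E <= mu (Y `\` (E `|` D)))%E.
  move=> mY cY; rewrite EFinB leeBlDr//; apply: (le_trans cY).
  have mYED : measurable (Y `\` (E `|` D)).
    by apply: measurableD => //; exact: measurableU.
  apply: le_trans (leeD2l _ Dr); apply: le_trans (measureU2 _ mYED mD).
  apply: le_mu; [exact: measurableD|exact: measurableU|].
  by move=> x [Yx Ex]; have [Dx|Dx] := pselect (D x);
    [right|left; split => // -[]].
elim: l => [_|A l IH ml] /=; first exact: remove.
have ml' B : B \in l -> measurable B by move=> Bl; apply: ml; rewrite inE Bl orbT.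
move=> [cA cl]; split; last exact: IH.
apply: remove => //; apply: measurableI; first by apply: ml; rewrite mem_head.
exact: measurable_foldrU.
Qed.

Section chain.
Variables (small : set X -> Prop) (delta : R).
Hypothesis delta0 : 0 < delta.
Hypothesis small_sub : forall A B, small B -> A `<=` B -> small A.
Hypothesis small_fin : forall A, measurable A -> small A -> (mu A < +oo)%E.
Hypothesis small_div : forall A, measurable A -> small A -> divisible A.
Notation tiled := (tileable (measure_tile small delta)).

(** Divisibility cuts off one tile after another. The multiple has to be positive, since a nonempty
    null set has no tiling. *)
Lemma tileable_multiple n A : measurable A -> small A ->
  mu A = (delta *+ n.+1)%:E -> tiled A.
Proof.
elim: n A => [|n IH] A mA sA nA; first by apply: tileable1.
have [||P [mP PA Pd]] := small_div mA sA (t := delta).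
- exact: ltW.
- by rewrite nA lee_fin mulrS lerDl mulrn_wge0// ltW.
rewrite -(setDUK PA); apply: tileableU.
- by split => //; exact: small_sub PA.
- apply: IH; first exact: measurableD.
  + by apply: small_sub sA _ => x [].
  + move: (mu_setD mA mP PA); rewrite nA Pd => /eqP.
    have := small_fin (measurableD mA mP) (small_sub sA (@subDsetl _ A P)).
    rewrite -ge0_fin_numE ?measure_ge0// => /fineK <-.
    by rewrite -EFinD eqe mulrSr => /eqP/addIr ->.
- exact: setDIK.
Qed.

(** Each peeled piece borrows at most [delta] from the rest, so [c] drops by at most [delta] per
    step. The bound [delta *+ (size l).+1 <= c] pays for all peelings and leaves [A0] with positive
    measure. *)
Lemma tileable_overlapping l A0 E N c : measurable E ->
  (forall A, A \in A0 :: l -> measurable A /\ small A) ->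
  delta *+ (size l).+1 <= c -> overlapping c E A0 l ->
  mu (foldr setU A0 l `\` E) = (delta *+ N)%:E ->
  tiled (foldr setU A0 l `\` E).
Proof.
elim: l E N c => [|A l IH] E N c mE mls dc /=.
  move=> cA0 N0; have [mA0 sA0] := mls _ (mem_head _ _).
  (* The case [N = 0] is impossible: what is left of [A0] has measure at least [c], hence at least
     [delta]. *)
  case: N N0 => [|N] N0; last first.
    apply: tileable_multiple N0; first exact: measurableD.
    exact: small_sub (@subDsetl _ _ _).
  move: cA0; rewrite N0 lee_fin mulr0n leNgt => /negP[].
  exact: lt_le_trans dc.
move=> [cA cl]; set B := foldr setU A0 l => NE.
have [mA sA] : measurable A /\ small A by apply: mls; rewrite !inE eqxx orbT.
have mls' A' : A' \in A0 :: l -> measurable A' /\ small A'.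
  rewrite inE => /orP[/eqP->|A'l]; first by apply: mls; rewrite mem_head.
  by apply: mls; rewrite !inE A'l !orbT.
have [mA0 sA0] := mls' _ (mem_head _ _).
have ml A' : A' \in l -> measurable A'.
  by move=> A'l; apply: (mls' A' _).1; rewrite inE A'l orbT.
have mB : measurable B by exact: measurable_foldrU.
have mBE : measurable (B `\` E) by exact: measurableD.
have fin_sub D : measurable D -> D `<=` (A `|` B) `\` E -> mu D \is a fin_num.
  move=> mD DAB; rewrite ge0_fin_numE//.
  apply: le_lt_trans (ltry (delta *+ N)); rewrite -NE; apply: le_mu => //.
  by apply: measurableD => //; exact: measurableU.
(* The part [Q] of [A] lying in no other piece is completed, by a set [R]
   borrowed from the overlap, to the next multiple of [delta]. *)
pose Q := (A `\` B) `\` E.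
have mQ : measurable Q by apply: measurableD => //; exact: measurableD.
have Qfin : mu Q \is a fin_num.
  by apply: fin_sub => // x [[Ax _] Ex]; split => //; left.
pose q := fine (mu Q); have muQ : mu Q = q%:E by rewrite fineK.
have q0 : 0 <= q by rewrite fine_ge0.
(* If [q] is itself a multiple of [delta], even zero, a whole [delta] is borrowed. The target
   [delta *+ k.+1] is thus always a positive multiple. *)
pose k := Num.truncn (q / delta).
have /andP[kq qk] : delta *+ k <= q < delta *+ k.+1.
  have := truncn_itv (divr_ge0 q0 (ltW delta0)); rewrite -/k.
  by rewrite ler_pdivlMr// ltr_pdivrMr// !mulr_natl.
pose r := delta *+ k.+1 - q.
have r0 : 0 <= r by rewrite subr_ge0 ltW.
have rd : r <= delta by rewrite /r mulrSr; lra.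
have mAB : measurable ((A `&` B) `\` E).
  by apply: measurableD => //; exact: measurableI.
have sAB : small ((A `&` B) `\` E) by apply: small_sub sA _ => x [[]].
have [||R0 [mR RAB muR]] := small_div mAB sAB (t := r) => //.
  apply: le_trans cA; rewrite lee_fin (le_trans rd)// (le_trans _ dc)//.
  by rewrite mulrS lerDl mulrn_wge0// ltW.
have QR0 : Q `&` R0 = set0.
  by apply/seteqP; split => // x [[[_ Bx] _] /RAB[[_ /Bx]]].
(* The completed piece [Q] with [R0] is tiled directly; the rest has the same shape as before, with
   [E] enlarged by [R0], and is left to induction. *)
have -> : (A `|` B) `\` E = (Q `|` R0) `|` (B `\` (E `|` R0)).
  apply/seteqP; split => x /=.
    move=> [ABx Ex]; have [Bx|Bx] := pselect (B x); last first.
      by case: ABx => // Ax; left; left.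
    by have [Rx|Rx] := pselect (R0 x); [left; right|right; split => // -[]].
  move=> [[[[Ax Bx] Ex]|/RAB[[Ax Bx] Ex]]|[Bx]]; try by split => //; left.
  by move=> /not_orP[Ex Rx]; split => //; right.
have RBE : R0 `<=` B `\` E by move=> x /RAB[[]].
have BER : B `\` (E `|` R0) = (B `\` E) `\` R0 by rewrite setDDl.
have BEfin : mu (B `\` E) \is a fin_num.
  by apply: fin_sub => // x [Bx Ex]; split => //; right.
have muBE : q + fine (mu (B `\` E)) = delta *+ N.
  apply: EFin_inj; rewrite EFinD -muQ (fineK BEfin) -NE -mu_setU//.
    congr (mu _); apply/seteqP; split => x /=.
      by move=> [[[Ax _] Ex]|[Bx Ex]]; split => //; [left|right].
    move=> [ABx Ex]; have [Bx|Bx] := pselect (B x); first by right.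
    by case: ABx => // Ax; left.
  by apply/seteqP; split => // x [[[_ Bx] _] [/Bx]].
have muBER : mu (B `\` (E `|` R0)) = (delta *+ N - delta *+ k.+1)%:E.
  have BERfin : mu (B `\` (E `|` R0)) \is a fin_num.
    apply: fin_sub => [|x [Bx /not_orP[Ex _]]]; last by split => //; right.
    by apply: measurableD => //; exact: measurableU.
  have := mu_setD mBE mR RBE; rewrite muR -BER -(fineK BEfin) -(fineK BERfin).
  by rewrite -EFinD => -[BRr]; congr (_%:E); move: muBE; rewrite BRr /r; lra.
(* The remainder has nonnegative measure, so the natural subtraction [N - k.+1] below does not
   truncate. *)
have kN : (k.+1 <= N)%N.
  have : (0 <= mu (B `\` (E `|` R0)))%E by [].
  by rewrite muBER lee_fin subr_ge0 -[delta]mulr1 -!mulrnAr ler_pM2l// ler_nat.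
apply: tileable_disjU.
- apply: (@tileable_multiple k).
  + exact: measurableU.
  + by apply: small_sub sA _ => x [[[]]|/RAB[[]]].
  + by rewrite mu_setU// muQ muR -EFinD /r; congr (_%:E); lra.
- apply: (IH _ (N - k.+1)%N (c - delta)).
  + exact: measurableU.
  + exact: mls'.
  + by rewrite lerBrDr -mulrSr.
  + apply: overlapping_remove => //.
    by rewrite muR lee_fin.
  + by rewrite -/B muBER mulrnBr.
- by apply/seteqP; split => // x [[[[_ Bx] _]|Rx] [/= Bx' /not_orP[]]].
Qed.

End chain.
End measure_tilings.

(** * Finite covers, Borel sets and Borel measures *)

(* [g_sigma_algebraType] and [compact_cover] only apply to pointed types. *)
Definition pointed_at (T : topologicalType) (e : T) : Type := T.
HB.instance Definition _ (T : topologicalType) (e : T) :=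
  Topological.on (pointed_at e).
HB.instance Definition _ (T : topologicalType) (e : T) :=
  isPointed.Build (pointed_at e) e.

Lemma compact_finite_cover (T : topologicalType) (K : set T) (f : T -> set T) :
  compact K -> (forall x, open (f x)) -> (forall x, f x x) ->
  exists s : seq T, forall x, K x -> exists2 y, y \in s & f y x.
Proof.
(* A nonempty [K] supplies the base point; an empty one is covered by the empty list. *)
have [[e _] cK fo fx|K0 _ _ _] := pselect (K !=set0); last first.
  by exists [::] => x Kx; exfalso; apply: K0; exists x.
have : @compact (pointed_at e) K by [].
rewrite compact_cover => /(_ T K f)[x _|x Kx|D _ KD]; first exact: fo.
  by exists x.
by exists (finmap.enum_fset D) => x /KD[y Dy fyx]; exists y.
Qed.

Definition borel_at (T : topologicalType) (e : T) :=
  g_sigma_algebraType ([set A | open A] : set (set (pointed_at e))).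

Lemma measure_of_borel (R : realType) (T : topologicalType) (e : T)
    (nu : set T -> \bar R) :
  nu set0 = 0%E -> (forall A, borel A -> (0 <= nu A)%E) ->
  (forall F : nat -> set T, (forall n, borel (F n)) -> trivIset setT F ->
    (fun n => \sum_(0 <= i < n) nu (F i))%E @ \oo --> nu (\bigcup_n F n)) ->
  exists mu : {measure set (borel_at e) -> \bar R},
    forall A : set T, borel A -> mu A = nu A.
Proof.
move=> nu0 nu_ge0 nu_sigma.
(* Nothing is known of [nu] outside the Borel sets, whereas a measure must be nonnegative on every
   set; the maximum with zero repairs this. *)
pose m (A : set (borel_at e)) : \bar R := maxe 0%E (nu A).
have mE A : borel A -> m A = nu A by move=> /nu_ge0/max_idPr.
have m0 : m set0 = 0%E by rewrite /m nu0 maxxx.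
have m_ge0 A : (0 <= m A)%E by rewrite /m le_max lexx.
have m_sigma : semi_sigma_additive m.
  move=> F mF tF mUF; rewrite [X in _ --> X](mE _ mUF).
  under eq_fun do under eq_bigr do rewrite (mE _ (mF _)).
  exact: nu_sigma.
pose mm := isMeasure.Build _ _ _ m m0 m_ge0 m_sigma.
by exists (HB.pack_for {measure set (borel_at e) -> \bar R} m mm).
Qed.

Lemma borel_open (T : topologicalType) (A : set T) : open A -> borel A.
Proof. exact: sub_sigma_algebra. Qed.

Lemma borel_closed (T : topologicalType) (A : set T) : closed A -> borel A.
Proof.
move=> /closed_openC oA; rewrite -[A]setCK -setTD.
by apply: sigma_algebraCD; exact: borel_open.
Qed.

(** The sets with Borel preimage form a sigma-algebra containing the open sets. *)
Lemma borel_preimage (S T : topologicalType) (f : S -> T) (A : set T) :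
  continuous f -> borel A -> borel (f @^-1` A).
Proof.
move=> fc; move/(_ [set B | borel (f @^-1` B)]); apply; split; last first.
  by move=> O /= oO; apply: borel_open; exact: open_comp.
split => /=.
- by rewrite preimage_set0; exact: sigma_algebra0.
- by move=> B fB; exact: (sigma_algebraCD fB).
- by move=> F fF; rewrite preimage_bigcup; exact: sigma_algebra_bigcup.
Qed.

Lemma tileable_ord (X : Type) (tile : set X -> Prop) (A : set X) :
  tileable tile A -> exists n (P : 'I_n -> set X),
    [/\ forall i, tile (P i), forall i j, i != j -> P i `&` P j = set0 &
        \bigcup_(i in [set: 'I_n]) P i = A].
Proof.
elim=> [|P A' tP _ [n [Q [tQ dQ UQ]]] PA'].
  exists 0%N, (fun=> set0); split=> [[]//|[]//|].
  by rewrite -subset0 => x [[]].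
have PQ i : P `&` Q i = set0.
  by rewrite -subset0 -PA' -UQ => x [Px Qx]; split => //; exists i.
exists n.+1, (fun i => if unlift ord0 i is Some j then Q j else P); split.
- by move=> i; case: unliftP.
- move=> i j; case: unliftP => [i' ->|->]; case: unliftP => [j' ->|->] //.
  + by rewrite (inj_eq lift_inj); exact: dQ.
  + by rewrite setIC.
- rewrite -UQ; apply/seteqP; split=> [x [i _]|x [Px|[i _ Qx]]].
  + by case: unliftP => [i' _|_]; [right; exists i'|left].
  + by exists ord0 => //; rewrite unlift_none.
  + by exists (lift ord0 i) => //; rewrite liftK.
Qed.

Lemma tileable_sub (X : Type) (tile tile' : set X -> Prop) (A : set X) :
  (forall P, tile P -> tile' P) -> tileable tile A -> tileable tile' A.
Proof.
by move=> tt'; elim=> [|P B /tt' tP _ IH PB]; [left|exact: tileableU].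
Qed.

(** * Translates and neighborhoods in a topological group *)

Section topological_group.
Context (T : topologicalType) (mul : T -> T -> T) (inv : T -> T) (e : T).
Hypothesis topG : is_topological_group mul inv e.

Lemma tg_mulA x y z : mul x (mul y z) = mul (mul x y) z.
Proof. by case: topG => -[]. Qed.
Lemma tg_mul1l x : mul e x = x. Proof. by case: topG => -[_ /(_ x)[]]. Qed.
Lemma tg_mul1r x : mul x e = x. Proof. by case: topG => -[_ /(_ x)[]]. Qed.
Lemma tg_mulVl x : mul (inv x) x = e. Proof. by case: topG => -[_ _ /(_ x)[]]. Qed.
Lemma tg_mulVr x : mul x (inv x) = e. Proof. by case: topG => -[_ _ /(_ x)[]]. Qed.
Lemma tg_mulK x y : mul (inv x) (mul x y) = y.
Proof. by rewrite tg_mulA tg_mulVl tg_mul1l. Qed.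
Lemma tg_mulVK x y : mul x (mul (inv x) y) = y.
Proof. by rewrite tg_mulA tg_mulVr tg_mul1l. Qed.
Lemma tg_inv_uniq x y : mul x y = e -> inv x = y.
Proof. by move=> xy; rewrite -[inv x]tg_mul1r -xy tg_mulK. Qed.
Lemma tg_invK x : inv (inv x) = x. Proof. exact/tg_inv_uniq/tg_mulVl. Qed.
Lemma tg_inv1 : inv e = e. Proof. exact/tg_inv_uniq/tg_mul1l. Qed.
Lemma tg_invM x y : inv (mul x y) = mul (inv y) (inv x).
Proof. by apply: tg_inv_uniq; rewrite -tg_mulA tg_mulVK tg_mulVr. Qed.

Lemma mull_continuous g : continuous (mul g).
Proof.
case: topG => _ cmul _ x.
apply: (@continuous_comp _ _ _ (fun y => (g, y)) (fun p => mul p.1 p.2)).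
  by apply: cvg_pair; [exact: cvg_cst|exact: cvg_id].
exact: cmul.
Qed.

(** As preimages, translates inherit openness and Borel measurability and commute with set
    operations. *)
Lemma ltransE g A : ltrans mul g A = mul (inv g) @^-1` A.
Proof.
apply/seteqP; split=> [_ [x Ax <-]|x Ax] /=; first by rewrite tg_mulK.
by exists (mul (inv g) x) => //; rewrite tg_mulVK.
Qed.

Lemma ltrans_set1 g x : ltrans mul g [set x] = [set mul g x].
Proof. by rewrite /ltrans image_set1. Qed.

Lemma ltransM g h A : ltrans mul g (ltrans mul h A) = ltrans mul (mul g h) A.
Proof. by rewrite !ltransE tg_invM; apply/seteqP; split => x /=; rewrite tg_mulA. Qed.

Lemma borel_ltrans g A : borel A -> borel (ltrans mul g A).
Proof. by rewrite ltransE; apply: borel_preimage; exact: mull_continuous. Qed.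

Lemma open_ltrans g A : open A -> open (ltrans mul g A).
Proof. by rewrite ltransE; apply: open_comp => x _; exact: mull_continuous. Qed.

Lemma compact_ltrans g A : compact A -> compact (ltrans mul g A).
Proof.
apply: continuous_compact; apply: continuous_subspaceT.
exact: mull_continuous.
Qed.

Definition mul_set A B : set T := [set mul p.1 p.2 | p in A `*` B].

Lemma compact_mul_set A B : compact A -> compact B -> compact (mul_set A B).
Proof.
move=> cA cB; apply: continuous_compact; last exact: compact_setX.
by apply: continuous_subspaceT; case: topG.
Qed.

(** Continuity of multiplication at [(e, e)] gives neighborhoods with product in [U], and regularity
    of a compact neighborhood shrinks them to a closed one. Intersecting with the compact [K], then
    with the inverse image, gives compactness and symmetry. *)
Lemma compact_symmetric_nbhs U : hausdorff_space T ->
  locally_compact [set: T] -> nbhs e U ->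
  exists V, [/\ compact V, nbhs e V, forall v, V v -> V (inv v) &
    mul_set V V `<=` U].
Proof.
move=> hT lcT Ue.
have [K Ke [cK _]] : compact_near (nbhs e).
  by have := lcT e I; rewrite withinET.
have [cmul cinv] : continuous (fun p : T * T => mul p.1 p.2) /\ continuous inv.
  by case: topG.
have [[W1 W2] /= [W1e W2e] WU] : nbhs (e, e) [set p : T * T | U (mul p.1 p.2)].
  by apply: (cmul (e, e)); rewrite /= tg_mul1l.
have [W We WW] : filter_from (nbhs e) closure (W1 `&` W2).
  by apply: (compact_regular hT cK Ke); exact: filterI.
pose V0 := K `&` closure W.
have cV0 : compact V0 by apply: compact_closedI => //; exact: closed_closure.
have V0e : nbhs e V0.
  by apply: filterI => //; apply: filterS We; exact: subset_closure.
exists (V0 `&` inv @^-1` V0); split.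
- apply: compact_closedI => //; apply: closed_comp => //.
  exact: compact_closed.
- by apply: filterI => //; apply: cinv; rewrite tg_inv1.
- by move=> v [V0v V0v']; split => //=; rewrite tg_invK.
- move=> _ [[v w] [/= [[_ /WW[W1v _]] _] [[_ /WW[_ W2w]] _]] <-].
  exact: (WU (v, w)).
Qed.

(** * The subgroup generated by [V] and its left cosets *)

Section generated_subgroup.
Context (V : set T).
Hypothesis Vinv : forall v, V v -> V (inv v).

(** Only right products with elements of [V] are formed; as [V] is closed under inverses, this
    monoid is already a subgroup. *)
Inductive generated : T -> Prop :=
| generated1 : generated e
| generatedMr x v : generated x -> V v -> generated (mul x v).

Lemma generatedM x y : generated x -> generated y -> generated (mul x y).
Proof.
move=> gx; elim=> [|y' v _ gxy Vv]; first by rewrite tg_mul1r.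
by rewrite tg_mulA; exact: generatedMr.
Qed.

Lemma generated_gen v : V v -> generated v.
Proof. by rewrite -{2}[v]tg_mul1l; apply: generatedMr; exact: generated1. Qed.

Lemma generatedV x : generated x -> generated (inv x).
Proof.
elim=> [|y v _ gy Vv]; first by rewrite tg_inv1; exact: generated1.
by rewrite tg_invM; apply: generatedM => //; apply/generated_gen/Vinv.
Qed.

(* Every point is reached from [e] or from an earlier point by a step in [V];
   the base point [e] is left implicit, and later points come first. *)
Inductive chain : seq T -> Prop :=
| chain0 : chain [::]
| chainS s v l : s \in e :: l -> V v -> chain l -> chain (mul s v :: l).

Lemma chain_generated l : chain l -> forall x, x \in e :: l -> generated x.
Proof.
elim=> [|s v l' sl Vv _ IH] x.
  by rewrite inE => /eqP->; exact: generated1.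
rewrite !inE => /or3P[/eqP->|/eqP->|xl].
- exact: generated1.
- by apply: generatedMr => //; exact: IH.
- by apply: IH; rewrite inE xl orbT.
Qed.

(** The successive prefixes of a word in [V] representing [x] are appended to the chain. *)
Lemma chain_extend l x : chain l -> generated x ->
  exists l', [/\ chain l', {subset l <= l'} & x \in e :: l'].
Proof.
move=> cl; elim=> [|y v _ [l' [cl' ll' yl']] Vv].
  by exists l; split => //; rewrite mem_head.
exists (mul y v :: l'); split; first exact: chainS.
- by move=> z /ll' zl'; rewrite inE zl' orbT.
- by rewrite !inE eqxx orbT.
Qed.

Lemma chain_cover (F : seq T) : (forall x, x \in F -> generated x) ->
  exists2 l, chain l & {subset F <= e :: l}.
Proof.
elim: F => [|x F IH] gF; first by exists [::] => //; exact: chain0.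
have [|l cl Fl] := IH; first by move=> y yF; apply: gF; rewrite inE yF orbT.
have [l' [cl' ll' xl']] := chain_extend cl (gF x (mem_head _ _)).
exists l' => // y; rewrite inE => /predU1P[->//|/Fl].
by rewrite !inE => /predU1P[->|/ll' ->]; rewrite ?eqxx ?orbT.
Qed.

(** The entries represent pairwise distinct left cosets of the generated subgroup. *)
Fixpoint separated (J : seq T) : Prop :=
  if J is j :: J' then
    (forall i, i \in J' -> ~ generated (mul (inv i) j)) /\ separated J'
  else True.

(** Representatives are chosen greedily. The subgroup factors of all [g] are gathered in one list
    [F], so that a single set built over [F] serves every coset. *)
Lemma coset_representatives (gs : seq T) :
  exists J F : seq T, [/\ separated J, forall x, x \in F -> generated x &
    forall g, g \in gs -> exists j x, [/\ j \in J, x \in F & g = mul j x]].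
Proof.
elim: gs => [|g gs [J [F [sJ gF gsJF]]]].
  by exists [::], [::]; split.
have [[j jJ gj]|nJ] :=
    pselect (exists2 j, j \in J & generated (mul (inv j) g)).
  exists J, (mul (inv j) g :: F); split => //.
    by move=> x; rewrite inE => /predU1P[->|/gF].
  move=> h; rewrite inE => /predU1P[->|/gsJF[i [x [iJ xF ->]]]].
    by exists j, (mul (inv j) g); rewrite mem_head tg_mulVK.
  by exists i, x; rewrite inE xF orbT.
exists (g :: J), (e :: F); split => /=.
- by split => // j jJ gj; apply: nJ; exists j.
- by move=> x; rewrite inE => /predU1P[->|/gF//]; exact: generated1.
- move=> h; rewrite inE => /predU1P[->|/gsJF[i [x [iJ xF ->]]]].
    by exists g, e; rewrite !mem_head tg_mul1r.
  by exists i, x; rewrite !inE iJ xF !orbT.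
Qed.

(** A common point [g a = h b] would put the quotient of [g] by [h], which equals [b] times the
    inverse of [a], in the subgroup. *)
Lemma ltrans_disjoint C g h : C `<=` generated ->
  ~ generated (mul (inv h) g) -> ltrans mul g C `&` ltrans mul h C = set0.
Proof.
move=> Cgen; apply: contra_notP => /eqP/set0P[x [[a Ca ax] [b Cb bx]]].
have -> : mul (inv h) g = mul b (inv a).
  by rewrite -[g in LHS]tg_mul1r -(tg_mulVr a) (tg_mulA g) ax -bx -tg_mulA tg_mulK.
by apply: generatedM; [exact: Cgen|apply/generatedV/Cgen].
Qed.

Lemma tileable_separated (tile : set T -> Prop) C J :
  (forall g P, tile P -> tile (ltrans mul g P)) -> C `<=` generated ->
  tileable tile C -> separated J ->
  tileable tile (\big[setU/set0]_(j <- J) ltrans mul j C).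
Proof.
move=> tile_ltrans Cgen tC.
have tgC g : tileable tile (ltrans mul g C).
  elim: tC => [|P A tP _ IH PA]; first by rewrite ltransE preimage_set0; left.
  rewrite ltransE preimage_setU -!ltransE; apply: tileableU => //.
    exact: tile_ltrans.
  by rewrite !ltransE -preimage_setI PA preimage_set0.
elim: J => [|j J IH] /=; first by rewrite big_nil => _; left.
move=> [jJ sJ]; rewrite big_cons; apply: tileable_disjU => //; first exact: IH.
rewrite big_distrr/= big_seq big1// => i iJ.
by apply: ltrans_disjoint => //; exact: jJ.
Qed.

End generated_subgroup.
End topological_group.

Lemma foldr_setU_map (I : eqType) (X : Type) (F : I -> set X) i0 (l : seq I) :
  foldr setU (F i0) (map F l) = \bigcup_(i in [set` i0 :: l]) F i.
Proof.
elim: l => [|i l IH] /=; first by rewrite set_cons1 bigcup_set1.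
rewrite IH; apply/seteqP; split=> x.
  move=> [Fx|[j + Fx]]; first by exists i => //=; rewrite !inE eqxx orbT.
  by rewrite /= inE => jl; exists j => //=; rewrite !inE orbCA jl orbT.
move=> [j + Fx]; rewrite /= !inE orbCA => /predU1P[<-|jl]; first by left.
by right; exists j => //=; rewrite inE.
Qed.

(** * Null points, small covers and overlaps for Haar measure *)

Section haar.
Context (R : realType) (T : topologicalType).
Context (mul : T -> T -> T) (inv : T -> T) (e : T) (nu : set T -> \bar R).
Hypothesis topG : is_topological_group mul inv e.
Hypothesis hT : hausdorff_space T.
Hypothesis haar : haar_measure mul nu.

Lemma haar_borel_measure : exists mu : {measure set (borel_at e) -> \bar R},
  forall A : set T, borel A -> mu A = nu A.
Proof. by case: haar => nu0 [nu_ge0 [nu_sigma _]]; exact: measure_of_borel. Qed.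

Lemma haar_ltrans g A : borel A -> nu (ltrans mul g A) = nu A.
Proof. by case: haar => _ [_ [_ [+ _]]]; apply. Qed.

Lemma haar_compact (K : set T) : compact K -> (nu K < +oo)%E.
Proof. by case: haar => _ [_ [_ [_ [+ _]]]]; apply. Qed.

Lemma haar_open O : open O -> O !=set0 -> (0 < nu O)%E.
Proof. by case: haar => _ [_ [_ [_ [_ [+ _]]]]]; apply. Qed.

Lemma haar_outer A y : borel A -> (nu A < y)%E ->
  exists O, [/\ open O, A `<=` O & (nu O < y)%E].
Proof.
case: haar => _ [_ [_ [_ [_ [_ [outer _]]]]]] bA; rewrite outer//.
by move=> /ereal_inf_lt[_ [D [oD AD] <-] Dy]; exists D.
Qed.

Lemma borel_compact (K : set T) : compact K -> borel K.
Proof. by move=> cK; apply: borel_closed; exact: compact_closed. Qed.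

Lemma haar_le A B : borel A -> borel B -> A `<=` B -> (nu A <= nu B)%E.
Proof.
have [mu muE] := haar_borel_measure.
by move=> bA bB AB; rewrite -!muE//; exact: (le_mu mu bA bB).
Qed.

(** If points had positive mass, outer regularity would give an open set around [e] of measure less
    than two point masses. It would contain no second point, so by translation every point would be
    open. *)
Lemma haar_set1 x : ~ discrete_topology_on T -> nu [set x] = 0%E.
Proof.
move=> ndT.
have b1 (y : T) : borel [set y] by apply: borel_compact; exact: compact_set1.
have nu1 y : nu [set y] = nu [set e].
  by rewrite -[y](tg_mul1r topG) -ltrans_set1 haar_ltrans.
have [mu muE] := haar_borel_measure.
rewrite nu1; apply/eqP; apply: contra_notT ndT => ne0.
have nue0 : (0 < nu [set e])%E by rewrite lt0e ne0 -muE/=.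
have fin : nu [set e] \is a fin_num.
  by rewrite ge0_fin_numE ?(ltW nue0)//; apply: haar_compact; exact: compact_set1.
have [|O [oO eO Oe]] := @haar_outer [set e] (nu [set e] + nu [set e])%E (b1 e).
  by rewrite lteDl.
have OE : O = [set e].
  apply/seteqP; split => // y Oy; apply: contrapT => /= ye.
  move: Oe; rewrite ltNge => /negP; apply.
  rewrite -[X in (_ + X)%E](nu1 y) -!muE//; last exact: borel_open.
  rewrite -mu_setU; [|exact: b1|exact: b1|]; last first.
    by apply/seteqP; split => // z [/= -> ey]; apply: ye.
  apply: le_mu; [|exact: borel_open|by move=> z [/eO|/= ->]].
  by apply: measurableU; exact: b1.
move=> y; rewrite -[y](tg_mul1r topG) -ltrans_set1 -OE.
exact: (open_ltrans topG).
Qed.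

(** Points are null, so outer regularity gives each one an open neighborhood of measure at most
    [eps]; compactness selects finitely many. This feeds [divisible_fine_cover]. *)
Lemma haar_small_cover (K : set T) eps : ~ discrete_topology_on T -> compact K ->
  0 < eps -> exists2 ws : seq (set T),
    (forall W, W \in ws -> borel W /\ (nu W <= eps%:E)%E) &
    forall x, K x -> exists2 W, W \in ws & W x.
Proof.
move=> ndT cK eps0.
have : forall x, exists O, [/\ open O, O x & (nu O <= eps%:E)%E].
  move=> x; have [||O [oO xO Oe]] := @haar_outer [set x] eps%:E.
  - by apply: borel_compact; exact: compact_set1.
  - by rewrite haar_set1.
  - by exists O; split => //; [exact: xO|exact: ltW].
move=> /choice[f fP].
have [x|x|s Ks] := compact_finite_cover cK (f := f).
- by have [] := fP x.
- by have [] := fP x.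
exists (map f s).
  move=> _ /mapP[x _ ->]; have [oO _ Oe] := fP x.
  by split => //; exact: borel_open.
by move=> x /Ks[y sy fx]; exists (f y) => //; exact: map_f.
Qed.

(** For a new center [s v], the translate [(s v) V] lies both in [(s v) V V] and in the earlier
    piece [s V V]. By left invariance its measure is that of [V]. *)
Lemma chain_overlapping (mu : {measure set (borel_at e) -> \bar R}) V c l :
  (forall A : set T, borel A -> mu A = nu A) -> compact V -> V e ->
  (forall v, V v -> V (inv v)) -> nu V = c%:E -> chain mul e V l ->
  overlapping mu c set0 (ltrans mul e (mul_set mul V V))
    [seq ltrans mul s (mul_set mul V V) | s <- l].
Proof.
move=> muE cV Ve Vinv Vc cl; set W := mul_set mul V V.
have cW : compact W by exact: (compact_mul_set topG).
have bV : borel V by exact: borel_compact.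
have VW s v : V v -> ltrans mul s V `<=` ltrans mul (mul s v) W.
  move=> Vv _ [w Vw <-]; exists (mul (inv v) w).
    by exists (inv v, w) => //; split => //=; exact: Vinv.
  by rewrite -(tg_mulA topG) (tg_mulVK topG).
have bW s : borel (ltrans mul s W).
  by apply: borel_compact; exact: (compact_ltrans topG).
have overlap (s : T) (Y : set T) : borel Y -> ltrans mul s V `<=` Y ->
    (c%:E <= mu (Y `\` set0))%E.
  move=> bY sVY; rewrite setD0 muE// -Vc -(haar_ltrans s)//.
  by apply: haar_le => //; exact: (borel_ltrans topG).
elim: cl => [|s v l' sl Vv cl' IH] /=.
  apply: (overlap e) => //; rewrite -{2}(tg_mul1r topG e); exact: VW.
split => //; rewrite (foldr_setU_map (fun s => ltrans mul s W)).
apply: (overlap (mul s v)).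
  rewrite bigcup_seq; apply: borel_compact; apply: compact_closedI.
    exact: (compact_ltrans topG).
  apply: compact_closed => //; apply: bigsetU_compact => t _.
  exact: (compact_ltrans topG).
rewrite subsetI; split; first by rewrite -{2}(tg_mul1r topG (mul s v)); exact: VW.
move=> _ [w Vw <-]; exists s => //; exists (mul v w); first by exists (v, w).
by rewrite (tg_mulA topG).
Qed.

End haar.

(** * Assembling the compact set and its partition *)

Theorem theorem5 (R : realType) (T : topologicalType)
    (mul : T -> T -> T) (inv : T -> T) (e : T) (nu : set T -> \bar R) :
  is_lc_group mul inv e ->
  ~ discrete_topology_on T ->
  unimodular_haar mul nu ->
  forall (U : set T) (B : set T), nbhs e U -> compact B ->
  exists C : set T, [/\ compact C, B `<=` C &
    exists (n : nat) (P : 'I_n -> set T),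
      [/\ measurable_partition C P, U_fine mul U P & equisize nu P]].
Proof.
move=> [topG hT lcT] ndT [haar _] U B Ue cB.
have [V [cV Ve Vinv VVU]] := compact_symmetric_nbhs topG hT lcT Ue.
have Ve1 : V e by exact: nbhs_singleton.
have [mu muE] := haar_borel_measure e haar.
set W := mul_set mul V V in VVU.
have cW : compact W by exact: (compact_mul_set topG).
have VW : V `<=` W by move=> v Vv; exists (v, e) => //=; rewrite (tg_mul1r topG).
have bW s : borel (ltrans mul s W).
  by apply: (borel_compact hT); exact: (compact_ltrans topG).
have bV : borel V by exact: (borel_compact hT).
(* Smallness gives fineness because [W] lies in [U], and finiteness and divisibility because
   translates of [W] are compact. *)
pose small P := exists g, P `<=` ltrans mul g W.
have small_sub A D : small D -> A `<=` D -> small A.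
  by move=> [g Dg] AD; exists g; exact: subset_trans Dg.
have small_fin (A : set (borel_at e)) :
    measurable A -> small A -> (mu A < +oo)%E.
  move=> mA [g Ag]; rewrite muE//.
  apply: le_lt_trans (haar_le e haar mA (bW g) Ag) _.
  by rewrite (haar_ltrans haar) ?(haar_compact haar)//; exact: borel_compact.
have small_div (A : set (borel_at e)) :
    measurable A -> small A -> divisible mu A.
  move=> mA sA; apply: divisible_fine_cover; [exact: mA|exact: small_fin|].
  move=> eps eps0; have [g Ag] := sA.
  have [ws wsP wscov] := haar_small_cover topG hT haar ndT
    (compact_ltrans topG (g := g) cW) eps0.
  exists ws; last by move=> x /Ag/wscov.
  by move=> D /wsP[bD De]; split => //; rewrite muE.
have Vc : nu V = (fine (nu V))%:E.
  by rewrite fineK// ge0_fin_numE ?(haar_compact haar)// -muE.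
set c := fine (nu V) in Vc.
have c0 : 0 < c.
  rewrite -lte_fin -Vc; apply: lt_le_trans (haar_le e haar _ bV _).
  - by apply: (haar_open haar (open_interior V)); exists e.
  - by apply: borel_open; exact: open_interior.
  - exact: interior_subset.
have [gs Bgs] : exists gs : seq T,
    forall x, B x -> exists2 g, g \in gs & ltrans mul g V x.
  have [g|g|gs Bgs] := compact_finite_cover cB (f := fun g => ltrans mul g V^°).
  - by apply: (open_ltrans topG); exact: open_interior.
  - by exists e => //; exact: (tg_mul1r topG).
  - exists gs => x /Bgs[g g_gs gx]; exists g => //.
    by move: gx; apply: image_subset; exact: interior_subset.
(* Each center factors as [g = j x], so [g V] lies in [j C0] as soon as [x W] is one of the pieces
   of [C0]. *)
have [J [F [sJ gF gsJF]]] := coset_representatives topG V gs.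
have [l cl Fl] := chain_cover gF.
pose tileW s := ltrans mul s W.
pose C0 := foldr setU (tileW e) (map tileW l).
have C0E : C0 = \bigcup_(s in [set` e :: l]) tileW s by exact: foldr_setU_map.
have cC0 : compact C0.
  rewrite C0E bigcup_seq; apply: bigsetU_compact => s _.
  exact: (compact_ltrans topG).
have bC0 : borel C0 by exact: borel_compact.
have C0gen : C0 `<=` generated mul e V.
  rewrite C0E => _ [s sl [_ [[v w] [/= Vv Vw] <-] <-]].
  apply: (generatedM topG); first exact: chain_generated cl _ sl.
  by apply: (generatedM topG); exact: (generated_gen topG).
have C0m : nu C0 = (fine (nu C0))%:E.
  by rewrite fineK// ge0_fin_numE ?(haar_compact haar)// -muE.
set m := fine (nu C0) in C0m.
have m0 : 0 < m.
  apply: (lt_le_trans c0); rewrite -lee_fin -C0m -Vc.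
  apply: (haar_le e haar) => //; rewrite C0E => v Vv; exists e => /=.
    by rewrite mem_head.
  by exists v; [exact: VW|exact: (tg_mul1l topG)].
(* This [N] exceeds [m *+ (size l).+1 / c], so that [delta = m / N] fits the overlap budget and
   divides [m] exactly. *)
pose N := (Num.truncn (m *+ (size l).+1 / c)).+1.
pose delta := m / N%:R.
have N0 : 0 < N%:R :> R by rewrite ltr0n.
have delta0 : 0 < delta by rewrite divr_gt0.
have tC0 : tileable (measure_tile mu small delta) C0.
  rewrite -[C0](setD0 (C0 : set (borel_at e))).
  apply: (@tileable_overlapping _ (borel_at e) R mu small delta delta0 small_sub
    small_fin small_div (map tileW l) (tileW e) set0 N c).
  - exact: measurable0.
  - move=> A Al; have [s ->] : exists s, A = tileW s.
      move: Al; rewrite inE => /predU1P[->|/mapP[s _ ->]]; first by exists e.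
      by exists s.
    by split; [exact: bW|exists s].
  - rewrite size_map /delta -mulrnAl ler_pdivrMr//.
    rewrite mulrC -ler_pdivrMr//; apply/ltW; rewrite /N.
    have := truncn_itv (divr_ge0 (mulrn_wge0 (size l).+1 (ltW m0)) (ltW c0)).
    by move=> /andP[].
  - exact: (chain_overlapping topG hT haar).
  - rewrite setD0 muE// C0m; congr (_%:E).
    by rewrite /delta -[RHS]mulr_natr divfK// gt_eqF.
pose tile P := [/\ borel P, nu P = delta%:E & small P].
have tile_ltrans g P : tile P -> tile (ltrans mul g P).
  move=> [bP Pd [h Ph]]; split.
  - exact: (borel_ltrans topG).
  - by rewrite (haar_ltrans haar).
  - by exists (mul g h); rewrite -(ltransM topG); exact: image_subset.
pose C := \big[setU/set0]_(j <- J) ltrans mul j C0.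
have tC : tileable tile C.
  apply: (tileable_separated topG Vinv tile_ltrans C0gen) sJ.
  by apply: tileable_sub tC0 => P [bP Pd sP]; split => //; rewrite -muE.
exists C; split.
- by apply: bigsetU_compact => j _; exact: (compact_ltrans topG).
- move=> x /Bgs[g /gsJF[j [y [jJ yF ->]]]]; rewrite -(ltransM topG).
  move=> jyV; rewrite /C -bigcup_seq; exists j => //.
  move: jyV; apply: image_subset; rewrite C0E => z yVz; exists y.
    exact: Fl.
  by move: yVz; apply: image_subset.
- have [n [P [tP dP UP]]] := tileable_ord tC.
  exists n, P; split.
  + split => // i; first by have [] := tP i.
    (* Tiles are nonempty because their common measure [delta] is positive. *)
    apply/set0P/negP => /eqP Pi0; have [_ + _] := tP i.
    rewrite Pi0; case: haar => -> _ [] /esym/eqP; rewrite gt_eqF//.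
  + move=> i; have [_ _ [g Pg]] := tP i; exists g.
    by apply: subset_trans Pg _; exact: image_subset.
  + by move=> i j; have [_ -> _] := tP i; have [_ -> _] := tP j.
Qed.
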